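(* Let $A, A_0,\dots,A_m$ be real symmetric $n\times n$ matrices, $b,b_0,\dots,b_m\in\mathbb{R}^n$, $c,c_0,\dots,c_m\in\mathbb{R}$, and let $f(x)=x^TAx+b^Tx+c$ and $g_i(x)=x^TA_ix+b_i^Tx+c_i$, $i=0,1,\dots,m$. Consider the quadratic program $$(P_1)\quad \inf_{x}\ f(x)\quad\text{s.t.}\quad x\in\mathbb{R}^n_+,\ g_i(x)\le 0,\ i=0,1,\dots,m,$$ and assume that its feasible set is nonempty. Let $(D_1)$ be its semi-Lagrangian dual $$(D_1)\quad \sup_{u\in\mathbb{R}^{m+1}_+}\ \inf_{x\in\mathbb{R}^n_+}\Big\{f(x)+\sum_{i=0}^m u_i g_i(x)\Big\}.$$ If $(P_1)$ is convexifiable, then $\inf(P_1)=\sup(D_1)$ (as elements of $[-\infty,+\infty)$). In particular, if $(P_1)$ is strongly convexifiable and $\inf(P_1)>-\infty$, then $\min(P_1)=\sup(D_1)$, i.e. the infimum in $(P_1)$ is attained and equals $\sup(D_1)$.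
   Context: Let $$\mathcal{A}_{P_1}:=\{(g_0(x),g_1(x),\dots,g_m(x),f(x)) : x\in\mathbb{R}^n_+\}+\mathbb{R}^{m+2}_+ .$$ The problem $(P_1)$ is called convexifiable if $$(\{0_{\mathbb{R}^{m+1}}\}\times\mathbb{R})\cap \operatorname{cl}\operatorname{conv}\mathcal{A}_{P_1}=(\{0_{\mathbb{R}^{m+1}}\}\times\mathbb{R})\cap\mathcal{A}_{P_1},$$ where $\operatorname{cl}$ and $\operatorname{conv}$ denote closure and convex hull. It is called strongly convexifiable if $\mathcal{A}_{P_1}$ is closed and convex. Here $\mathbb{R}^k_+$ denotes the nonnegative orthant, and $\inf(\cdot)$, $\sup(\cdot)$ denote optimal values in the extended reals. *)

(* Defs.v *)
From mathcomp Require Import all_boot all_order all_algebra.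
From mathcomp Require Import all_classical all_reals all_analysis.

Set Implicit Arguments.
Unset Strict Implicit.
Unset Printing Implicit Defensive.

Import Order.TTheory GRing.Theory Num.Theory.
Import numFieldNormedType.Exports.

Local Open Scope classical_set_scope.
Local Open Scope ring_scope.

Definition orthant (R : numDomainType) (k : nat) : set 'cV[R]_k :=
  [set x | forall i, 0 <= x i 0].
Arguments orthant : clear implicits.

Definition quadratic (R : pzRingType) (n : nat)
    (A : 'M[R]_n) (b : 'cV[R]_n) (c : R) (x : 'cV[R]_n) : R :=
  (x^T *m A *m x) 0 0 + (b^T *m x) 0 0 + c.

Definition convex_hull (R : numDomainType) (M : lmodType R) (X : set M) :
    set M :=
  smallest (@convex_set R M) X.

(* In the program, the index type 'I_m.+1 of the constraints is {0, ..., m}. *)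
Section Program.
Variables (R : realType) (n m : nat).
Variables (f : 'cV[R]_n -> R) (g : 'I_m.+1 -> 'cV[R]_n -> R).

Definition feasible : set 'cV[R]_n :=
  orthant R n `&` [set x | forall i, g i x <= 0].

Definition primal_value : \bar R := ereal_inf [set (f x)%:E | x in feasible].

Definition dual_value : \bar R :=
  ereal_sup
    [set ereal_inf [set (f x + \sum_(i < m.+1) u i 0 * g i x)%:E
                   | x in orthant R n]
    | u in orthant R m.+1].

(* R^(m+2) is split as 'cV[R]_(m.+1 + 1): the constraint values come first
   and the objective value is the last entry. *)
Definition program_set : set 'cV[R]_(m.+1 + 1) :=
  [set y + z
  | y in [set col_mx (\col_i g i x) (f x)%:M | x in orthant R n]
  & z in orthant R (m.+1 + 1)].

Definition vertical_axis : set 'cV[R]_(m.+1 + 1) :=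
  [set col_mx 0 r%:M | r in [set: R]].

Definition convexifiable : Prop :=
  vertical_axis `&` closure (convex_hull program_set)
  = vertical_axis `&` program_set.

Definition strongly_convexifiable : Prop :=
  closed program_set /\ @convex_set R 'cV[R]_(m.+1 + 1) program_set.

End Program.

(* Main.v *)
(* If [r < inf (P_1)] then [(0, r)] is not in the set A_{P_1}, hence, by
   convexifiability, not in the closure of its convex hull; a hyperplane
   strictly separating the two has a normal that is nonnegative, because
   A_{P_1} is upward closed, and positive in the last coordinate, because the
   program is feasible; after normalization it is a
   multiplier showing [r <= sup (D_1)]. Attainment under strong
   convexifiability follows from closedness, as [(0, inf (P_1))] is a limit of
   points [(0, t)] of A_{P_1}. *)
Require Import Defs.
From mathcomp Require Import all_boot all_order all_algebra.
From mathcomp Require Import all_classical all_reals all_analysis.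
From mathcomp Require Import ring lra.

Import Order.TTheory GRing.Theory Num.Theory.
Import numFieldNormedType.Exports.

Local Open Scope classical_set_scope.
Local Open Scope ring_scope.

(** * Nearest points and separation of a point from a convex set *)

Lemma trmx_continuous (K : numFieldType) (m n : nat) :
  continuous (@trmx K m n).
Proof.
move=> M s /= /(nbhs_ballP M^T) [e e0 es].
apply/nbhs_ballP; exists e => //= N [_ MN]; apply: es.
by split=> // i j; rewrite !mxE; exact: MN.
Qed.

(** With one endpoint fixed, a convex combination is continuous in the other, so the endpoints can
    be moved into the closure one at a time. *)
Lemma closure_convex (R : numFieldType) (V : normedModType R) (C : set V) :
  @convex_set R V C -> @convex_set R V (closure C).
Proof.
move=> Cconv x y t; rewrite !inE => xC yC.
have comb_cts (a b : R) (v : V) : continuous (fun w : V => a *: w + b *: v).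
  by move=> w; apply: cvgD; [exact: cvgZl_tmp|exact: cvg_cst].
have closure_comb (a b : R) (v : V) :
    (forall w, C w -> closure C (a *: w + b *: v)) ->
    forall w, closure C w -> closure C (a *: w + b *: v).
  move=> Cab w wC.
  have /continuous_closedP cts := comb_cts a b v.
  have /closure_id preE := cts _ (@closed_closure _ C).
  suff : ((fun w => a *: w + b *: v) @^-1` closure C) w by [].
  by rewrite preE; exact: closureS wC.
rewrite /conv /=.
apply: (closure_comb _ _ _ _ _ xC) => {xC}x xC.
rewrite addrC; apply: (closure_comb _ _ _ _ _ yC) => {yC}y yC.
apply: subset_closure; rewrite addrC.
by have := Cconv x y t; rewrite !inE; apply.
Qed.

(** Euclidean rather than the sup norm carried by matrices: a nearest point must yield a normal
    vector. *)
Definition sqdist {R : pzRingType} {k : nat} (x y : 'cV[R]_k) : R :=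
  \sum_i (x i 0 - y i 0) ^+ 2.

Lemma sqdist_continuous (R : realType) (k : nat) (p : 'cV[R]_k) :
  continuous (fun x : 'cV[R]_k => sqdist x p).
Proof.
apply: continuous_big => [|i _ x]; first exact: add_continuous.
have coordB_cts : {for x, continuous (fun y : 'cV[R]_k => y i 0 - p i 0)}.
  apply: (@continuousB _ R^o 'cV[R]_k); first exact: coord_continuous.
  exact: cst_continuous.
exact: (@continuousM _ 'cV[R]_k _ _ _ coordB_cts coordB_cts).
Qed.

Lemma nearest_point (R : realType) (k : nat) (S : set 'cV[R]_k) (p : 'cV[R]_k) :
  closed S -> S !=set0 ->
  exists2 y, S y & forall z, S z -> sqdist y p <= sqdist z p.
Proof.
move=> Scl [y0 Sy0].
(* Cutting [S] down to the sublevel set through [y0] makes it compact; rows replace columns to fit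
   [bounded_closed_compact] and [EVT_min_rV]. *)
pose T := [set v : 'rV[R]_k | S v^T /\ sqdist v^T p <= sqdist y0 p].
have sqdist_tr_cts : continuous (fun v : 'rV[R]_k => sqdist v^T p).
  move=> v; apply: (@continuous_comp _ 'cV[R]_k _ trmx (fun x : 'cV[R]_k => sqdist x p)).
    exact: trmx_continuous.
  exact: sqdist_continuous.
have Tcl : closed T.
  apply: (@closedI _ (trmx @^-1` S)
    ((fun v : 'rV[R]_k => sqdist v^T p) @^-1` [set r | r <= sqdist y0 p])).
    by move/continuous_closedP : (@trmx_continuous R 1 k); exact.
  by move/continuous_closedP : sqdist_tr_cts; apply; exact: closed_le.
have Tbd : bounded_set T.
  (* No square root is taken: [a ^+ 2 <= D] gives [a <= D + 1] since [(a - 1) ^+ 2] is nonnegative.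
     The term in [p] recentres at the origin. *)
  exists (sqdist y0 p + 1 + `|p^T|); split=> [|M /ltW BM v [_ vp] /=].
    exact: num_real.
  apply: le_trans BM.
  rewrite -(subrK p^T v) (le_trans (ler_normD _ _))// lerD2r.
  rewrite [leLHS]mx_normrE; apply/bigmax_leP => /=.
  have D0 : 0 <= sqdist y0 p by apply: sumr_ge0 => i _; exact: sqr_ge0.
  split=> [|[i j] _ /=]; first by rewrite addr_ge0.
  have : (v i j - p j 0) ^+ 2 <= sqdist y0 p.
    apply: le_trans vp; rewrite (ord1 i) /sqdist (bigD1 j)//= !mxE lerDl.
    by apply: sumr_ge0 => l _; exact: sqr_ge0.
  rewrite !mxE (ord1 i) -(real_normK (num_real _)).
  have sqr_lb (a : R) : a ^+ 2 <= sqdist y0 p -> a <= sqdist y0 p + 1.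
    by move=> a2; have := sqr_ge0 (a - 1); nra.
  exact: sqr_lb.
have T0 : T !=set0 by exists y0^T; split; rewrite trmxK.
have [v /set_mem [Sv vy0] vmin] := EVT_min_rV T0
  (bounded_closed_compact Tbd Tcl) (continuous_subspaceT sqdist_tr_cts).
exists v^T => // z Sz.
have [zy0|/ltW] := leP (sqdist z p) (sqdist y0 p); last exact: le_trans.
by have := vmin z^T; rewrite trmxK; apply; rewrite inE; split; rewrite trmxK.
Qed.

Definition dot {R : pzRingType} {k : nat} (w x : 'cV[R]_k) : R :=
  \sum_i w i 0 * x i 0.

(** The hyperplane passes through the point [y] of the closure nearest to [p], with normal
    [y - p]. *)
Lemma convex_separation (R : realType) (k : nat) (C : set 'cV[R]_k) (p : 'cV[R]_k) :
  @convex_set R 'cV[R]_k C -> C !=set0 -> ~ closure C p ->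
  exists w a, dot w p < a /\ forall z, C z -> a <= dot w z.
Proof.
move=> Cconv [z0 Cz0] pC.
have subcl : C `<=` closure C by exact: subset_closure.
have [y yC ymin] := @nearest_point R k _ p (@closed_closure _ C)
  (ex_intro _ z0 (subcl _ Cz0)).
have cl_conv := @closure_convex R _ _ Cconv.
exists (y - p), (dot (y - p) y); split.
  (* The gap is the squared distance from [y] to [p], which vanishes only if [p] lies in the
     closure. *)
  rewrite -subr_gt0 /dot -sumrB.
  rewrite (eq_bigr (fun i => (y i 0 - p i 0) ^+ 2)); last first.
    by move=> i _; rewrite !mxE; ring.
  rewrite lt_def sumr_ge0 ?andbT; last by move=> i _; exact: sqr_ge0.
  apply/negP; rewrite psumr_eq0 => [|i _]; last exact: sqr_ge0.
  move=> /allP yp; apply: pC; suff <- : y = p by [].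
  apply/colP => i; apply/eqP; rewrite -subr_eq0 -sqrf_eq0.
  by apply: yp; rewrite mem_index_enum.
move=> z Cz; rewrite -subr_ge0 /dot -sumrB.
set s := \sum_i _.
(* First-order optimality of the nearest point [y] along [[y, z]]. *)
have key (t : R) : 0 <= t <= 1 -> 0 <= 2 * t * s + t ^+ 2 * sqdist z y.
  move=> /andP[t0 t1].
  have := ymin (t *: z + (1 - t) *: y).
  have : closure C (t *: z + (1 - t) *: y).
    have := cl_conv z y (Itv01 t0 t1); rewrite !inE; apply => //.
    exact: subcl.
  move=> + h => /h {h}; rewrite -subr_ge0 /sqdist -sumrB => h.
  apply: le_trans h _; rewrite le_eqVlt; apply/orP; left; apply/eqP.
  rewrite !mulr_sumr -big_split /=; apply: eq_bigr => i _.
  by rewrite !mxE; ring.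
have N0 : 0 <= sqdist z y by apply: sumr_ge0 => i _; exact: sqr_ge0.
rewrite leNgt; apply/negP => s0.
have d0 : 0 < sqdist z y - s by lra.
(* This [t] lies in []0, 1]] even if [sqdist z y] is zero, and turns the bound of [key] into
   [t * s * (1 + t)], which is negative. *)
have := key (- s / (sqdist z y - s)); set t := - s / _.
have t0 : 0 < t by rewrite divr_gt0// oppr_gt0.
have tE : t * (sqdist z y - s) = - s by rewrite divfK// gt_eqF.
have t1 : t <= 1 by rewrite ler_pdivrMr// mul1r; lra.
rewrite (ltW t0) t1 => /(_ isT).
nra.
Qed.

(** * Duality and attainment for the program *)

Section Duality.
Variables (R : realType) (n m : nat).
Variables (f : 'cV[R]_n -> R) (g : 'I_m.+1 -> 'cV[R]_n -> R).

Lemma program_setP (y : 'cV[R]_(m.+1 + 1)) :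
  program_set f g y <->
  exists2 x, orthant R n x &
    (forall i, g i x <= y (lshift 1 i) 0) /\ f x <= y (rshift m.+1 0) 0.
Proof.
split=> [[_ [x x0 <-] [z z0 <-]]|[x x0 [gy fy]]].
  exists x => //; split=> [i|]; rewrite mxE ?col_mxEu ?col_mxEd !mxE lerDl; exact: z0.
exists (col_mx (\col_i g i x) (f x)%:M); first by exists x.
exists (y - col_mx (\col_i g i x) (f x)%:M); last by rewrite addrC subrK.
move=> i; rewrite !mxE subr_ge0; case: splitP => j ij; rewrite !mxE.
  by rewrite (_ : i = lshift 1 j)//; exact: val_inj.
rewrite (ord1 j) (_ : i = rshift m.+1 0)//; apply: val_inj.
by rewrite /= ij (ord1 j).
Qed.

(** With zero constraint entries, domination of the values at [x] becomes feasibility of [x]; this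
    translates the geometry back to the program. *)
Lemma axis_program_setP (r : R) :
  program_set f g (col_mx 0 r%:M) <-> exists2 x, feasible g x & f x <= r.
Proof.
rewrite program_setP; split=> [[x x0 [gx fx]]|[x [x0 gx] fx]]; exists x => //.
- by split=> // i; have := gx i; rewrite col_mxEu mxE.
- by move: fx; rewrite col_mxEd mxE.
- split=> [i|]; first by rewrite col_mxEu mxE.
  by rewrite col_mxEd mxE.
Qed.

(** At a feasible point the penalty term is nonpositive. *)
Lemma weak_duality : (dual_value f g <= primal_value f g)%E.
Proof.
apply: ge_ereal_sup => _ [u u0 <-]; apply: le_ereal_inf_tmp => _ [x [x0 gx] <-].
apply: (@le_trans _ _ (f x + \sum_(i < m.+1) u i 0 * g i x)%:E).
  by apply: ereal_inf_lbound; exists x.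
rewrite lee_fin gerDl; apply: sumr_le0 => i _.
by rewrite mulr_ge0_le0//; exact: u0.
Qed.

Lemma dual_lower_bound (r : R) :
  feasible g !=set0 ->
  ~ closure (convex_hull (program_set f g)) (col_mx 0 r%:M) ->
  (r%:E <= dual_value f g)%E.
Proof.
move=> [x0 [x00 gx0]] rC.
have sub_hull : program_set f g `<=` convex_hull (program_set f g).
  exact: sub_gen_smallest.
have hull_conv : @convex_set R 'cV[R]_(m.+1 + 1) (convex_hull (program_set f g)).
  move=> x y t; rewrite !inE => xC yC B [Bconv subB].
  have := Bconv x y t; rewrite !inE; apply; [exact: xC|exact: yC].
have hull0 : convex_hull (program_set f g) !=set0.
  exists (col_mx 0 (f x0)%:M); apply: sub_hull.
  by apply/axis_program_setP; exists x0.
have [w [a [wr wC]]] := convex_separation _ _ _ _ hull_conv hull0 rC.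
have dotE (y : 'cV[R]_(m.+1 + 1)) : dot w y =
    \sum_(i < m.+1) w (lshift 1 i) 0 * y (lshift 1 i) 0
    + w (rshift m.+1 0) 0 * y (rshift m.+1 0) 0.
  by rewrite /dot big_split_ord/= big_ord1.
(* The set contains the ray from [y] in direction [j]; a negative [w j 0] would make [dot w]
   unbounded below on it. *)
have w_ge0 j : 0 <= w j 0.
  rewrite leNgt; apply/negP => wj.
  have [y Py] : program_set f g !=set0.
    by exists (col_mx 0 (f x0)%:M); apply/axis_program_setP; exists x0.
  have Pt t : 0 <= t -> program_set f g (y + t *: delta_mx j 0).
    move=> t0; apply/program_setP; have [x xp [gy fy]] := (program_setP _).1 Py.
    exists x => //; split=> [i|].
      by rewrite (le_trans (gy i))// !mxE lerDl mulr_ge0.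
    by rewrite (le_trans fy)// !mxE lerDl mulr_ge0.
  have dotD t : dot w (y + t *: delta_mx j 0) = dot w y + t * w j 0.
    rewrite /dot (eq_bigr (fun i => w i 0 * y i 0 + t * (w i 0 * (i == j)%:R))).
      rewrite big_split/= -mulr_sumr; congr (_ + t * _).
      by rewrite (bigD1 j)//= eqxx mulr1 big1 ?addr0// => i /negbTE ->; rewrite mulr0.
    by move=> i _; rewrite !mxE andbT; ring.
  have [t t0 tw] : exists2 t, 0 <= t & dot w y + t * w j 0 < a.
    (* Moving this far lowers [dot w] by [|dot w y - a| + 1], hence to at most [a - 1]. *)
    exists ((`|dot w y - a| + 1) / (- w j 0)).
      by rewrite divr_ge0 ?addr_ge0// oppr_ge0 ltW.
    have -> : (`|dot w y - a| + 1) / - w j 0 * w j 0 = - (`|dot w y - a| + 1).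
      by field; rewrite lt_eqF.
    by have := ler_norm (dot w y - a); lra.
  by have := wC _ (sub_hull _ (Pt t t0)); rewrite dotD leNgt tw.
have wL x : orthant R n x ->
    a <= \sum_(i < m.+1) w (lshift 1 i) 0 * g i x + w (rshift m.+1 0) 0 * f x.
  move=> xp; have /sub_hull/wC : program_set f g (col_mx (\col_i g i x) (f x)%:M).
    apply/program_setP; exists x => //.
    by split=> [i|]; rewrite ?col_mxEu ?col_mxEd mxE.
  rewrite dotE col_mxEd mxE/=; congr (_ <= _ + _).
  by apply: eq_bigr => i _; rewrite col_mxEu mxE.
set v := w (rshift m.+1 0) 0 in wL.
have {}wr : v * r < a.
  move: wr; rewrite dotE big1 ?add0r => [|i _].
    by rewrite col_mxEd mxE.
  by rewrite col_mxEu mxE mulr0.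
(* If [v] were zero, [wr] would give [0 < a], whereas [wL] at the feasible [x0] bounds [a] by a
   nonpositive sum. *)
have v_gt0 : 0 < v.
  rewrite lt_def w_ge0 andbT; apply/negP => /eqP v0.
  have := wL _ x00; rewrite v0 mul0r addr0 leNgt => /negP; apply.
  apply: le_lt_trans wr; rewrite v0 mul0r; apply: sumr_le0 => i _.
  by rewrite mulr_ge0_le0//; exact: gx0.
apply: (@le_trans _ _ (ereal_inf [set (f x + \sum_(i < m.+1)
    (\col_i (w (lshift 1 i) 0 / v)) i 0 * g i x)%:E | x in orthant R n])).
  apply: le_ereal_inf_tmp => _ [x xp <-]; rewrite lee_fin.
  rewrite -(ler_pM2l v_gt0) (le_trans (ltW wr))// (le_trans (wL _ xp))//.
  rewrite mulrDr addrC lerD2l mulr_sumr ler_sum// => i _.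
  by rewrite !mxE mulrA mulrCA divff ?gt_eqF// mulr1.
apply: ereal_sup_ubound; exists (\col_i (w (lshift 1 i) 0 / v)) => // i.
by rewrite mxE divr_ge0// ltW.
Qed.

Lemma convexifiable_strong_duality :
  feasible g !=set0 -> convexifiable f g -> primal_value f g = dual_value f g.
Proof.
move=> feas0 cvx; apply/le_anti; rewrite weak_duality andbT.
have dual_ge (r : R) : (r%:E < primal_value f g)%E -> (r%:E <= dual_value f g)%E.
  move=> rp; apply: dual_lower_bound => // rC.
  have : (@vertical_axis R m `&` program_set f g) (col_mx 0 r%:M).
    by rewrite -cvx; split=> //; exists r.
  move=> [_ /axis_program_setP [x xfeas fxr]].
  move: rp; rewrite ltNge => /negP; apply.
  apply: (@le_trans _ _ (f x)%:E); last by rewrite lee_fin.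
  by apply: ereal_inf_lbound; exists x.
(* [dual_ge] covers only reals strictly below the value, so a finite [p] is approached by [p - e]; a
   feasible point rules out [+oo]. *)
case E : (primal_value f g) dual_ge => [p| |] dual_ge; last exact: leNye.
  apply/lee_subgt0Pr => e e0; apply: dual_ge.
  by rewrite lte_fin ltrBlDr ltrDl.
have [x xfeas] := feas0.
have : (primal_value f g <= (f x)%:E)%E by apply: ereal_inf_lbound; exists x.
by rewrite E.
Qed.

(** A closed convex set is its own closed convex hull. *)
Lemma strongly_convexifiable_convexifiable :
  strongly_convexifiable f g -> convexifiable f g.
Proof.
move=> [Pcl Pconv]; rewrite /convexifiable /convex_hull smallest_id//.
by move/closure_id : Pcl => <-.
Qed.

Lemma closed_primal_attained :
  closed (program_set f g) -> primal_value f g \is a fin_num ->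
  exists2 x, feasible g x & (f x)%:E = primal_value f g.
Proof.
move=> Pcl pfin; set p := fine (primal_value f g).
have pE : primal_value f g = p%:E by rewrite fineK.
suff [x xfeas fxp] : exists2 x, feasible g x & f x <= p.
  exists x => //; apply/le_anti; rewrite pE lee_fin fxp/= -pE.
  by apply: ereal_inf_lbound; exists x.
apply/axis_program_setP; move/closure_id : Pcl => ->.
move=> B /nbhs_ballP [e /= e0 eB].
have [_ [x xfeas <-]] := lb_ereal_inf_adherent e0 pfin.
rewrite -/(primal_value f g) pE -EFinD lte_fin => fxe.
(* The point [x] is optimal up to [e]; the maximum with [p] gives the difference from [p] a known
   sign while keeping it below [e]. *)
exists (col_mx 0 (Num.max p (f x))%:M); split.
  by apply/axis_program_setP; exists x; rewrite // le_max lexx orbT.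
apply: eB; split=> // i j; rewrite /ball /= !mxE.
case: splitP => k ik; rewrite !mxE ?subrr ?normr0//.
rewrite (ord1 k) (ord1 j)/= !mulr1n.
by rewrite distrC ger0_norm ?subr_ge0 ?le_max ?lexx// ltrBlDl gt_max fxe ltrDl e0.
Qed.

End Duality.

Theorem theorem2p1 (R : realType) (n m : nat)
    (A : 'M[R]_n) (b : 'cV[R]_n) (c : R)
    (Ag : 'I_m.+1 -> 'M[R]_n) (bg : 'I_m.+1 -> 'cV[R]_n) (cg : 'I_m.+1 -> R)
    (f := quadratic A b c)
    (g := fun i => quadratic (Ag i) (bg i) (cg i)) :
  A \is symmetricmx ->
  (forall i, Ag i \is symmetricmx) ->
  feasible g !=set0 ->
  (convexifiable f g ->
     (primal_value f g < +oo)%E /\ primal_value f g = dual_value f g) /\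
  (strongly_convexifiable f g -> (-oo < primal_value f g)%E ->
     exists2 x, feasible g x &
       (f x)%:E = primal_value f g /\ primal_value f g = dual_value f g).
Proof.
move=> _ _ feas0.
have plty : (primal_value f g < +oo)%E.
  have [x xfeas] := feas0; apply: le_lt_trans (ltry (f x)).
  by apply: ereal_inf_lbound; exists x.
split=> [cvx|scvx pgtNy]; first by split=> //; exact: convexifiable_strong_duality.
have [x xfeas fx] : exists2 x, feasible g x & (f x)%:E = primal_value f g.
  by apply: closed_primal_attained; [case: scvx|rewrite fin_numE gt_eqF ?lt_eqF].
exists x => //; split=> //; apply: convexifiable_strong_duality => //.
exact: strongly_convexifiable_convexifiable.
Qed.
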